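(* Let $d=1$ and let the dilation `matrix' be the number $2$, with quadratic form $P(\xi)=\xi^2$. Then for every $m\ge1$ the univariate elliptic scaling function $\phi^m$ of order $m$ is the (centered) cardinal B-spline of odd degree $2m-1$, i.e. $$\hat\phi^m(\xi)=\left(\frac{\sin(\xi/2)}{\xi/2}\right)^{2m},\qquad \xi\in\mathbb{R};$$ and, vice versa, every cardinal B-spline of odd degree arises in this way.
   Context: For $d=1$, dilation $2$ and $P(\xi)=\xi^2$, set $G(\xi):=4\sin^2(\xi/2)$ and define the mask $m_0(\xi):=G(\xi+\pi)/G(\pi)$. The elliptic scaling function $\phi$ is the tempered distribution with $\hat\phi(\xi)=\prod_{j=1}^\infty m_0(2^{-j}\xi)$, and the elliptic scaling function of order $m$ is $\phi^1:=\phi$, $\phi^m:=\phi*\phi^{m-1}$, i.e. $\hat\phi^m=(\hat\phi)^m$. The Fourier transform is $\hat f(\xi)=\int_{\mathbb{R}} f(x)e^{-i\xi x}\,dx$. The centered cardinal B-spline of degree $n$ is the $(n+1)$-fold convolution of the indicator function of $[-1/2,1/2]$ with itself. *)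

(* Defs.v *)
From HB Require Import structures.
From mathcomp Require Import all_boot all_order all_algebra.
From mathcomp Require Import all_classical all_reals all_analysis.
From mathcomp Require Import complex.
Set Implicit Arguments.
Unset Strict Implicit.
Unset Printing Implicit Defensive.
Import Order.TTheory GRing.Theory Num.Theory.
Import numFieldNormedType.Exports.
Local Open Scope classical_set_scope.
Local Open Scope ring_scope.
Local Open Scope complex_scope.

Section ComplexFunctions.
Context {R : realType}.
Local Notation mu := (@lebesgue_measure R).
Implicit Types f : R -> R[i].

Definition cintegral f : R[i] :=
  (\int[mu]_x complex.Re (f x)) +i* (\int[mu]_x complex.Im (f x)).

(* [R[i]] carries no normed [R]-module structure, so derivatives of
   complex-valued functions of a real variable are taken componentwise. *)
Definition csmooth f : Prop := forall (k : nat) (x : R),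
  derivable (derive1n k (fun y => complex.Re (f y))) x 1 /\
  derivable (derive1n k (fun y => complex.Im (f y))) x 1.

Definition cderiven (k : nat) f : R -> R[i] := fun x =>
  derive1n k (fun y => complex.Re (f y)) x +i*
  derive1n k (fun y => complex.Im (f y)) x.

Definition expi (t : R) : R[i] := cos t +i* sin t.

Definition fourier f : R -> R[i] := fun xi =>
  cintegral (fun x => f x * expi (- (xi * x))).

(* [M] bounds every Schwartz seminorm sup_x |x^j f^(k)(x)| with j, k <= N. *)
Definition seminorms_bounded (N : nat) (M : R) f : Prop :=
  forall (j k : nat) (x : R), (j <= N)%N -> (k <= N)%N ->
    Normc.normc ((x ^+ j)%:C * cderiven k f x) <= M.

Definition schwartz f : Prop :=
  csmooth f /\ forall N : nat, exists M : R, seminorms_bounded N M f.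

End ComplexFunctions.

Section TemperedDistributions.
Context {R : realType}.

(* A distribution is encoded by a functional on all functions R -> C of which
   only the restriction to the Schwartz space is meaningful: linearity and
   continuity are required there only, and equality of distributions is
   [distr_eq], not Leibniz equality. *)
Definition functional := (R -> R[i]) -> R[i].

Definition distr_eq (S T : functional) : Prop :=
  forall psi, schwartz psi -> S psi = T psi.

Definition tempered (T : functional) : Prop :=
  (forall (a : R[i]) (f g : R -> R[i]), schwartz f -> schwartz g ->
     T (fun x => a * f x + g x) = a * T f + T g) /\
  (exists (N : nat) (C : R), forall (f : R -> R[i]) (M : R), schwartz f ->
     seminorms_bounded N M f -> Normc.normc (T f) <= C * M).

Definition distr_of (g : R -> R[i]) : functional := fun psi =>
  cintegral (fun x => g x * psi x).

(* The Fourier transform maps Schwartz functions to Schwartz functions, so on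
   the Schwartz space this only evaluates [T] where it is meaningful. *)
Definition distr_fourier (T : functional) : functional := fun psi =>
  T (fourier psi).

End TemperedDistributions.

Section EllipticScaling.
Context {R : realType}.

Definition G (xi : R) : R := 4 * sin (xi / 2) ^+ 2.

Definition m0 (xi : R) : R := G (xi + pi) / G pi.

Definition phihat_partial (xi : R) (n : nat) : R :=
  \prod_(1 <= j < n.+1) m0 (2 ^- j * xi).

Definition phihat (xi : R) : R := limn (phihat_partial xi).

(* [phi^m] is the [m]-fold convolution power of [phi]; convolution of these
   tempered distributions is multiplication on the Fourier side, so the Fourier
   transform of [phi^m] is the function [phihat ^+ m]. *)
Definition phihat_order (m : nat) (xi : R) : R := phihat xi ^+ m.

Definition elliptic_scaling (m : nat) (T : functional) : Prop :=
  tempered T /\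
  distr_eq (distr_fourier T) (distr_of (fun xi => (phihat_order m xi)%:C)).

End EllipticScaling.

Section BSplines.
Context {R : realType}.
Local Notation mu := (@lebesgue_measure R).

Definition convolution (f g : R -> R) : R -> R := fun x =>
  \int[mu]_t (f (x - t) * g t).

Definition box : R -> R := \1_(`[- (2^-1), 2^-1]%classic : set R).

Fixpoint bspline (n : nat) : R -> R :=
  if n is n'.+1 then convolution (bspline n') box else box.

Definition bspline_distr (n : nat) : functional :=
  distr_of (fun x => (bspline n x)%:C).

End BSplines.

(* sin x / x, with the removable singularity at 0 filled in. *)
Definition sinc {R : realType} (x : R) : R := if x == 0 then 1 else sin x / x.

(* Main.v *)
Require Import Defs.
From mathcomp Require Import all_boot all_order all_algebra.
From mathcomp Require Import all_classical all_reals all_analysis.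
From mathcomp Require Import measurable_realfun complex ring lra.
Import Order.TTheory GRing.Theory Num.Theory.
Import numFieldNormedType.Exports.
Set Implicit Arguments.
Unset Strict Implicit.
Unset Printing Implicit Defensive.
Local Open Scope classical_set_scope.
Local Open Scope ring_scope.
Local Open Scope complex_scope.

(** The mask is m0(xi) = cos(xi/2)^2, because sin((xi + pi)/2) = cos(xi/2). The
duplication formula in the form sinc y = cos(y/2) sinc(y/2) makes the product
telescope ([phihat_partialP]): the first n factors times sinc(xi/2^(n+1))^2
always equal sinc(xi/2)^2. Since sinc tends to 1 at 0, the infinite product is
sinc(xi/2)^2 ([phihatE]), and its m-th power is sinc(xi/2)^(2m).

On the other side, the box function has transform sinc(xi/2), and convolution
with a box multiplies the transform by sinc(xi/2)
([phase_transform_bspline]), so the B-spline of degree n has transform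
sinc(xi/2)^(n+1). For n = 2m - 1 the two agree, and every odd degree is of
this form. Moving the Fourier transform from the test function to the spline
by Fubini's theorem turns this into an identity of tempered distributions
([fourier_bspline]).

A distribution whose Fourier transform is prescribed is known only on test
functions that are themselves Fourier transforms. Uniqueness therefore
amounts to the surjectivity of the Fourier transform on the Schwartz space
([fourier_surjective]), that is, to Fourier inversion, and most of the work
goes into it. Everything is done with one family of real transforms,
W p u (xi) = integral of u(x) cos(xi x + p): the real and imaginary parts of
a Fourier transform are combinations of W 0 and W (-pi/2), and both
differentiating W p u and multiplying it by xi only shift the phase p by pi/2
while multiplying u by x or differentiating it. This gives stability of the
Schwartz space at once ([real_schwartz_phase_transform]). For the inversion
itself ([phase_transform_inversion]), W 0 v is integrated against exp(-e|x|);
self-adjointness of W 0 replaces this by the integral of v against the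
transform 2e/(e^2 + x^2) of the exponential, and letting e tend to 0 leaves
2 pi v(0). Applied to translates of u, this is the inversion formula at every
point. *)

(** * Integrable functions on the line and iterated integrals *)

(** Integrability is stated for the extended-real composite because that is
the form in which the integration theory uses it. *)
Definition integrable_on_R {R : realType} (f : R -> R) : Prop :=
  (@lebesgue_measure R).-integrable setT (EFin \o f).

Section Integrability.
Context {R : realType}.
Local Notation mu := (@lebesgue_measure R).
Local Notation L1 := (@integrable_on_R R).
Implicit Types f g h : R -> R.

Lemma L1_measurable f : L1 f -> measurable_fun setT f.
Proof. by move=> /measurable_int/measurable_EFinP. Qed.

Lemma L1_dominated f g : measurable_fun setT f -> L1 g ->
  (forall x, `|f x| <= `|g x|) -> L1 f.
Proof.
move=> mf ig fg; apply: (@le_integrable _ _ _ mu _ measurableT _ (EFin \o g)) => //.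
- exact/measurable_EFinP.
- by move=> x _; rewrite /= lee_fin fg.
Qed.

Lemma L1_add f g : L1 f -> L1 g -> L1 (fun x => f x + g x).
Proof. by move=> Lf Lg; exact: (integrableD measurableT Lf Lg). Qed.

Lemma L1_scale c f : L1 f -> L1 (fun x => c * f x).
Proof. by move=> Lf; exact: (integrableZl measurableT c Lf). Qed.

Lemma L1_sub f g : L1 f -> L1 g -> L1 (fun x => f x - g x).
Proof. by move=> Lf Lg; exact: (integrableB measurableT Lf Lg). Qed.

Lemma L1_norm f : L1 f -> L1 (fun x => `|f x|).
Proof. by move=> Lf; exact: (integrable_norm Lf). Qed.

Lemma L1_mul_bounded f g (C : R) : L1 f -> measurable_fun setT g ->
  (forall x, `|g x| <= C) -> L1 (fun x => f x * g x).
Proof.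
move=> Lf mg gC; apply: (L1_dominated (g := fun x => C * f x)).
- by apply: measurable_funM => //; exact: L1_measurable.
- exact: L1_scale.
- move=> x; rewrite !normrM mulrC ler_wpM2r//.
  by rewrite (le_trans (gC x))// ler_norm.
Qed.

Lemma integral_bound f (M : R) g : L1 f -> measurable_fun setT g ->
  (forall x, `|g x| <= M) ->
  `|\int[mu]_x (f x * g x)| <= (\int[mu]_x `|f x|) * M.
Proof.
move=> Lf mg gM.
have Lfg := L1_mul_bounded Lf mg gM.
apply: (le_trans (le_normr_Rintegral measurableT Lfg)).
rewrite -RintegralZr//; last exact: L1_norm.
apply: le_Rintegral => //.
- exact: L1_norm.
- by under eq_fun do rewrite /= mulrC; exact/(L1_scale M)/L1_norm.
- by move=> x _; rewrite normrM ler_wpM2l.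
Qed.

Section Fubini.
Variable f : R * R -> R.
Hypothesis Lf : (mu \x mu)%E.-integrable setT (EFin \o f).

Let inner1E : {ae mu, forall x,
  ((\int[mu]_y f (x, y))%R%:E = \int[mu]_y (f (x, y))%:E)%E}.
Proof.
apply: (filterS (Filter := ae_filter_ringOfSetsType mu) _ (ae_integrable1 Lf)).
move=> x Lx.
by rewrite /Rintegral fineK//; exact: integrable_fin_num.
Qed.

Let inner2E : {ae mu, forall y,
  ((\int[mu]_x f (x, y))%R%:E = \int[mu]_x (f (x, y))%:E)%E}.
Proof.
apply: (filterS (Filter := ae_filter_ringOfSetsType mu) _ (ae_integrable2 Lf)).
move=> y Ly.
by rewrite /Rintegral fineK//; exact: integrable_fin_num.
Qed.

Let measurable_inner1 : measurable_fun setT (fun x => \int[mu]_y f (x, y)).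
Proof. by apply: measurableT_comp => //; exact: (measurable_fubini_F Lf). Qed.

Let measurable_inner2 : measurable_fun setT (fun y => \int[mu]_x f (x, y)).
Proof. by apply: measurableT_comp => //; exact: (measurable_fubini_G Lf). Qed.

Lemma L1_inner : L1 (fun x => \int[mu]_y f (x, y)).
Proof.
have /integrableP[mF iF] := integrable_fubini_F Lf.
apply/integrableP; split; first by apply/measurable_EFinP; exact: measurable_inner1.
apply: le_lt_trans iF; rewrite le_eqVlt; apply/orP; left; apply/eqP.
apply: ae_eq_integral => //.
- by apply: measurableT_comp => //; apply/measurable_EFinP; exact: measurable_inner1.
- by apply: measurableT_comp.
- apply: (filterS (Filter := ae_filter_ringOfSetsType mu) _ inner1E).
  by move=> x /= Ex _; rewrite /fubini_F -Ex.
Qed.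

(** The inner integrals are finite only almost everywhere, so the real-valued
iterated integrals are compared with the extended-real ones of Fubini's theorem
through almost-everywhere equality. *)
Lemma Rintegral_swap : (\int[mu]_x \int[mu]_y f (x, y))
  = \int[mu]_y \int[mu]_x f (x, y).
Proof.
rewrite /Rintegral; congr fine.
transitivity (\int[mu]_x (fubini_F mu (EFin \o f) x))%E.
  apply: ae_eq_integral => //.
  - by apply/measurable_EFinP; exact: measurable_inner1.
  - exact: (measurable_fubini_F Lf).
  - apply: (filterS (Filter := ae_filter_ringOfSetsType mu) _ inner1E).
    by move=> x /= Ex _; rewrite /fubini_F -Ex.
rewrite (integral12_prod_meas1 Lf) -(integral21_prod_meas1 Lf); apply: ae_eq_integral => //.
- exact: (measurable_fubini_G Lf).
- by apply/measurable_EFinP; exact: measurable_inner2.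
- apply: (filterS (Filter := ae_filter_ringOfSetsType mu) _ inner2E).
  by move=> x /= Ex _; rewrite /fubini_G -Ex.
Qed.

End Fubini.

Lemma integrable_tensor f g (h : R * R -> R) (C : R) : L1 f -> L1 g ->
  measurable_fun setT h -> (forall z, `|h z| <= C) ->
  (mu \x mu)%E.-integrable setT (EFin \o (fun z => f z.1 * g z.2 * h z)).
Proof.
move=> Lf Lg mh hC.
have mf := L1_measurable Lf; have mg := L1_measurable Lg.
have mfg : measurable_fun setT (fun z : R * R => f z.1 * g z.2).
  by apply: measurable_funM; apply: measurableT_comp.
have Lfg : (mu \x mu)%E.-integrable setT (EFin \o (fun z => f z.1 * g z.2)).
  apply/integrable12ltyP; first exact/measurable_EFinP.
  have /integrableP[_ If] := Lf; have /integrableP[_ Ig] := Lg.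
  have Ig0 : (0 <= \int[mu]_y `|(g y)%:E|)%E by exact: integral_ge0.
  under eq_integral => x _.
    under eq_integral => y _ do rewrite /= normrM EFinM.
    rewrite ge0_integralZl//=; last first.
      by apply/measurable_EFinP; apply: measurableT_comp.
    over.
  rewrite ge0_integralZr//=; last first.
    by apply/measurable_EFinP; apply: measurableT_comp.
  by apply: lte_mul_pinfty => //; [exact: integral_ge0|
     rewrite ge0_fin_numE//; exact: integral_ge0].
apply: (@le_integrable _ _ _ (mu \x mu)%E _ measurableT _ (EFin \o (fun z : R * R => C * (f z.1 * g z.2)))).
- by apply/measurable_EFinP; apply: measurable_funM.
- move=> z _; rewrite /= lee_fin !normrM mulrC ler_wpM2r//.
  by rewrite (le_trans (hC z))// ler_norm.
- exact: (integrableZl measurableT C Lfg).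
Qed.

End Integrability.

(** * Affine changes of variable *)

Section ChangeOfVariable.
Context {R : realType}.
Local Notation mu := (@lebesgue_measure R).
Local Notation L1 := (@integrable_on_R R).
Implicit Types f g h : R -> R.

(** The hypothesis says that Lebesgue measure is k times its own image under
phi, so the two sides integrate f against the same measure. Arguing on measures
rather than on primitives covers discontinuous f, such as the box. *)
Lemma change_of_variable (phi : R -> R) (k : R) f : measurable_fun setT phi ->
  0 < k -> (forall A, measurable A -> mu A = (k%:E * mu (phi @^-1` A))%E) ->
  L1 f -> L1 (f \o phi) /\ \int[mu]_x f x = k * \int[mu]_x f (phi x).
Proof.
move=> mphi k0 muE Lf.
have mf := L1_measurable Lf.
have pos (g : R -> \bar R) : measurable_fun setT g -> (forall x, 0 <= g x)%E ->
    (\int[mu]_x g x = k%:E * \int[mu]_x g (phi x))%E.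
  move=> mg g0.
  pose mphi' := isMeasurableFun.Build _ _ (measurableTypeR R) (measurableTypeR R) phi mphi.
  pose Phi := MeasurableFun.Pack (MeasurableFun.Class mphi').
  have <- := (@ge0_integral_pushforward _ _ (measurableTypeR R) (measurableTypeR R) R phi mphi mu setT g) measurableT mg (fun x _ => g0 x).
  have <- := @ge0_integral_mscale _ (measurableTypeR R) R (pushforward mu Phi) setT measurableT (NngNum (ltW k0)) g mg (fun x _ => g0 x).
  apply: eq_measure_integral => A mA _; exact: muE.
have Lfphi : L1 (f \o phi).
  have /integrableP[_ If] := Lf.
  apply/integrableP; split; first by apply/measurable_EFinP; exact: (measurableT_comp mf mphi).
  move: If; rewrite (pos (fun x => `|(f x)%:E|)%E) //; last first.
    by apply: measurableT_comp => //; exact/measurable_EFinP.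
  have I0 : (0 <= \int[mu]_x `|(EFin \o (f \o phi)) x|)%E by exact: integral_ge0.
  move: I0; rewrite /=; case: (\int[mu]_x _)%E => [r||] //= _; first by move=> _; rewrite ltry.
  by rewrite gt0_muley.
split=> //.
rewrite /Rintegral integralE [in RHS]integralE.
rewrite (pos (EFin \o f)^\+%E) //; last by apply: measurable_funepos; exact/measurable_EFinP.
rewrite (pos (EFin \o f)^\-%E) //; last by apply: measurable_funeneg; exact/measurable_EFinP.
have Fp := integrable_pos_fin_num measurableT Lfphi.
have Fn := integrable_neg_fin_num measurableT Lfphi.
have -> : (fun x => (EFin \o f)^\+ (phi x))%E = (EFin \o (f \o phi))^\+%E.
  by apply/funext => x; rewrite !funeposE.
have -> : (fun x => (EFin \o f)^\- (phi x))%E = (EFin \o (f \o phi))^\-%E.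
  by apply/funext => x; rewrite !funenegE.
rewrite -muleBr//; last by apply: fin_num_adde_defl; rewrite fin_numN.
rewrite fineM// -integralE; exact: (integrable_fin_num measurableT Lfphi).
Qed.

(** By uniqueness of Lebesgue measure it is enough to compare the two
measures on half-open intervals. *)
Lemma integral_affine (a c : R) f : 0 < c -> L1 f ->
  L1 (fun x => f (a + c * x)) /\ \int[mu]_x f x = c * \int[mu]_x f (a + c * x).
Proof.
move=> c0 Lf; apply: change_of_variable => //.
  by apply: measurable_funD => //; apply: measurable_funM.
move=> A mA.
have mphi : @measurable_fun _ _ (measurableTypeR R) (measurableTypeR R) setT
    (fun x : R => a + c * x).
  by apply: measurable_funD => //; apply: measurable_funM.
pose nu : {measure set (measurableTypeR R) -> \bar R} := mscale (NngNum (ltW c0))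
  (measure_function_pushforward__canonical__measure_function_Measure mu mphi).
transitivity (nu A); last by [].
have nuP := @lebesgue_measure_unique R nu.
apply: nuP => // _ [[u v]] _ <-.
pose I : set R := `](u - a) / c, (v - a) / c]%classic.
transitivity (c%:E * mu I)%E; last first.
  congr (_ * mu _)%E.
  apply/seteqP; rewrite /I; split => x /=; rewrite !in_itv/= ltr_pdivrMr// ler_pdivlMr//;
    by rewrite ltrBlDl lerBrDl (mulrC x).
rewrite /I !lebesgue_measure_itv /= !lte_fin ltr_pM2r ?invr_gt0// ltrD2r.
case: ifP => uv; last by rewrite mule0.
by rewrite -!EFinB -EFinM; congr EFin; field; rewrite gt_eqF.
Qed.

Lemma integral_translate (a : R) f : L1 f ->
  L1 (fun x => f (a + x)) /\ \int[mu]_x f (a + x) = \int[mu]_x f x.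
Proof.
move=> Lf; have := integral_affine a ltr01 Lf.
have -> : (fun x => f (a + 1 * x)) = (fun x => f (a + x)).
  by apply/funext => x; rewrite mul1r.
by move=> [? ->]; rewrite mul1r.
Qed.

Lemma integral_reflect f : L1 f ->
  L1 (fun x => f (- x)) /\ \int[mu]_x f (- x) = \int[mu]_x f x.
Proof.
move=> Lf; have [||] := @change_of_variable -%R 1 f _ ltr01 _ Lf => //.
- by move=> A mA; rewrite mul1e -[LHS]lebesgue_measureN.
- by rewrite mul1r.
Qed.

End ChangeOfVariable.

(** * Dominated convergence and the fundamental theorem of calculus *)

Section FundamentalTheorem.
Context {R : realType}.
Local Notation mu := (@lebesgue_measure R).
Local Notation L1 := (@integrable_on_R R).
Implicit Types f g h : R -> R.

Lemma Rintegral_dominated_cvg (D : set R) (f_ : nat -> R -> R) f g :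
  measurable D -> (forall n, measurable_fun D (f_ n)) -> measurable_fun D f ->
  (forall x, D x -> f_ n x @[n --> \oo] --> f x) ->
  mu.-integrable D (EFin \o g) -> (forall n x, D x -> `|f_ n x| <= g x) ->
  \int[mu]_(x in D) f_ n x @[n --> \oo] --> \int[mu]_(x in D) f x.
Proof.
move=> mD mf_ mf cvgf Lg domf.
have := @dominated_convergence _ _ _ mu D mD (fun n => EFin \o f_ n) (EFin \o f) (EFin \o g).
case.
- by move=> n; apply/measurable_EFinP; exact: mf_.
- by apply/measurable_EFinP; exact: mf.
- by apply: aeW => x Dx; apply: cvg_EFin; [apply: nearW|exact: cvgf].
- exact: Lg.
- by apply: aeW => x n Dx; rewrite /= lee_fin domf.
move=> Lf _ H; apply: fine_cvg; rewrite fineK; first exact: H.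
exact: (@integrable_fin_num _ _ _ mu D mD _ Lf).
Qed.

(** The integrand may oscillate in sign, so integrability is a hypothesis: the
fundamental theorem on the intervals [a n, b n], which eventually contain each
point of D, then passes to the limit by dominated convergence. *)
Lemma FTC_exhaustion (D : set R) (F f : R -> R) (a b : nat -> R) (l : R) :
  measurable D -> (forall n, a n < b n) -> (forall n, `[a n, b n] `<=` D) ->
  (forall x, D x -> \forall n \near \oo, a n <= x <= b n) ->
  continuous f -> (forall x : R, is_derive x 1 F (f x)) ->
  mu.-integrable D (EFin \o f) ->
  F (b n) - F (a n) @[n --> \oo] --> l ->
  \int[mu]_(x in D) f x = l.
Proof.
move=> mD ab abD Dab cf dF Lf Fl.
pose f_ n : R -> R := f \_ `[a n, b n].
have mf : measurable_fun setT f by exact: continuous_measurable_fun.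
have mf_ n : measurable_fun D (f_ n).
  apply: measurable_funTS; apply/(measurable_restrictT _ _).1 => //.
  exact/measurable_funTS.
have cvgf x : D x -> f_ n x @[n --> \oo] --> f x.
  move=> Dx; apply: cvg_near_cst.
  near=> n; rewrite /f_ /patch ifT//.
  by rewrite inE /= in_itv /=; near: n; exact: Dab.
have domf n x : D x -> `|f_ n x| <= `|f x|.
  by move=> Dx; rewrite /f_ /patch; case: ifP => // _; rewrite normr0.
have := Rintegral_dominated_cvg mD mf_ (measurable_funTS mf) cvgf
  (integrable_norm Lf) domf.
have -> : (fun n => \int[mu]_(x in D) f_ n x) = (fun n => F (b n) - F (a n)).
  apply/funext => n.
  rewrite -Rintegral_mkcondr (setIidr (abD n)).
  rewrite /Rintegral (@continuous_FTC2 _ f F _ _ (ab n)) ?EFinB//.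
  - by apply: continuous_subspaceT.
  - split=> [x _||].
    + exact: ex_derive.
    + by apply: cvg_at_right_filter; apply: differentiable_continuous;
        apply/derivable1_diffP; exact: ex_derive.
    + by apply: cvg_at_left_filter; apply: differentiable_continuous;
        apply/derivable1_diffP; exact: ex_derive.
  - by move=> x _; rewrite derive1E derive_val.
by move=> H; exact: (cvg_unique _ H Fl).
Unshelve. all: end_near. Qed.

Lemma cvg_const_div_nat (M : R) : M / n.+1%:R @[n --> \oo] --> (0 : R).
Proof.
rewrite -[X in _ --> X](mulr0 M); apply: cvgM; first exact: cvg_cst.
exact: cvg_harmonic.
Qed.

(** The boundary terms F(n) - F(-n) are of order 1/n. *)
Lemma integral_derivative_eq0 (F f : R -> R) (M : R) : continuous f ->
  (forall x : R, is_derive x 1 F (f x)) -> L1 f -> (forall x, `|x * F x| <= M) ->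
  \int[mu]_x f x = 0.
Proof.
move=> cf dF Lf FM.
apply: (@FTC_exhaustion setT F f (fun n => - n.+1%:R) (fun n => n.+1%:R)) => //.
- by move=> n; apply: (@lt_trans _ _ 0); rewrite ?oppr_lt0 ltr0Sn.
- move=> x _; near=> n; rewrite -ler_norml.
  have : `|x| < n%:R by near: n; exact: nbhs_infty_gtr.
  by move/ltW/le_trans; apply; rewrite ler_nat.
- apply: norm_cvg0.
  apply: (@squeeze_cvgr _ _ _ _ (cst 0) (fun n => (2 * M) / n.+1%:R)).
  + near=> n; rewrite normr_ge0 /= ler_pdivlMr ?ltr0Sn//.
    set u := F n.+1%:R; set v := F (- n.+1%:R).
    have := FM n.+1%:R; have := FM (- n.+1%:R); rewrite -/u -/v !normrM normrN.
    rewrite (ger0_norm (ler0n R n.+1)) => hv hu.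
    rewrite mulrC (le_trans (ler_wpM2l (ler0n R n.+1) (ler_normB u v)))//.
    by rewrite mulrDr; lra.
  + exact: cvg_cst.
  + exact: cvg_const_div_nat.
Unshelve. all: end_near. Qed.

(** The integral over the negative half-line is the reflection of the other
one; the endpoint 0 is negligible. *)
Lemma integral_even f : L1 f -> (forall x, f (- x) = f x) ->
  \int[mu]_x f x = 2 * \int[mu]_(x in `[0, +oo[) f x.
Proof.
move=> Lf feven.
have LfD (D : set R) : measurable D -> mu.-integrable D (EFin \o f).
  by move=> mD; exact: (@integrableS _ _ _ mu _ _ _ measurableT mD (@subsetT _ _) Lf).
rewrite -(setUv `[0, +oo[%classic) setCitvr Rintegral_setU//=.
- rewrite Rintegral_itv_bndo_bndc; last exact: LfD.
  rewrite mulr_natl mulr2n; congr (_ + _).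
  rewrite [LHS]Rintegral_mkcond [RHS]Rintegral_mkcond.
  have Lg : L1 (f \_ `[0, +oo[).
    rewrite /integrable_on_R -restrict_EFin; apply/(integrable_mkcond _ _).1 => //.
    exact: LfD.
  have [_ <-] := integral_reflect Lg.
  apply: eq_Rintegral => x _; rewrite /patch !mem_setE !in_itv/= andbT oppr_ge0.
  by rewrite feven.
- by rewrite -setCitvr setUv.
- by rewrite -setCitvr; exact/disj_setPCl.
Qed.

Lemma integral_odd f : L1 f -> (forall x, f (- x) = - f x) ->
  \int[mu]_x f x = 0.
Proof.
move=> Lf fN; have [_] := integral_reflect Lf.
have -> : (fun x => f (- x)) = (fun x => -1 * f x).
  by apply/funext => x; rewrite fN mulN1r.
by rewrite RintegralZl// => H; lra.
Qed.
End FundamentalTheorem.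

(** * The cosine transform with a phase *)

(** The cosine transform with phase p. Phase 0 gives the cosine transform and
phase -pi/2 the sine transform; keeping p free lets derivatives and
multiplications by the variable be expressed as phase shifts. *)
Definition phase_transform {R : realType} (p : R) (u : R -> R) (xi : R) : R :=
  \int[@lebesgue_measure R]_x (u x * cos (xi * x + p)).

Section PhaseTransform.
Context {R : realType}.
Local Notation mu := (@lebesgue_measure R).
Local Notation L1 := (@integrable_on_R R).
Local Notation W := (@phase_transform R).
Implicit Types (f g u v : R -> R) (p q xi : R).

Lemma continuous_cos_affine (a p : R) : continuous (fun x : R => cos (a * x + p)).
Proof.
move=> x; apply: continuous_comp; last exact: continuous_cos.
by apply: cvgD; [apply: cvgM; [exact: cvg_cst|exact: cvg_id]|exact: cvg_cst].
Qed.

Lemma measurable_cos_affine (a p : R) :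
  measurable_fun setT (fun x : R => cos (a * x + p)).
Proof. by apply: continuous_measurable_fun; exact: continuous_cos_affine. Qed.

Lemma L1_mul_cos p u xi : L1 u -> L1 (fun x => u x * cos (xi * x + p)).
Proof.
move=> Lu; apply: (L1_mul_bounded (C := 1)) => //.
- exact: measurable_cos_affine.
- by move=> x; exact: cos_max.
Qed.

Lemma phase_transform_bound p u xi : L1 u -> `|W p u xi| <= \int[mu]_x `|u x|.
Proof.
move=> Lu; rewrite -[leRHS]mulr1; apply: integral_bound => //.
- exact: measurable_cos_affine.
- by move=> x; exact: cos_max.
Qed.

Lemma phase_transformD p u v xi : L1 u -> L1 v ->
  W p (fun x => u x + v x) xi = W p u xi + W p v xi.
Proof.
move=> Lu Lv; rewrite /phase_transform -RintegralD//; [|exact: L1_mul_cos..].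
by apply: eq_Rintegral => x _; rewrite mulrDl.
Qed.

Lemma phase_transformZ p (c : R) u xi : L1 u ->
  W p (fun x => c * u x) xi = c * W p u xi.
Proof.
move=> Lu; rewrite /phase_transform -RintegralZl//; last exact: L1_mul_cos.
by apply: eq_Rintegral => x _; rewrite mulrA.
Qed.

Lemma integrable_phase_kernel p f g : L1 f -> L1 g ->
  (mu \x mu)%E.-integrable setT
    (EFin \o (fun z => f z.1 * g z.2 * cos (z.1 * z.2 + p))).
Proof.
move=> Lf Lg; apply: (integrable_tensor (C := 1)) => // [|z]; last exact: cos_max.
apply: measurableT_comp; first exact: (continuous_measurable_fun (@continuous_cos R)).
by apply: measurable_funD => //; apply: measurable_funM.
Qed.

(** The kernel cos(x y + p) is symmetric in x and y, so this is Fubini's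
theorem. *)
Lemma phase_transform_selfadjoint p f g : L1 f -> L1 g ->
  \int[mu]_x (f x * W p g x) = \int[mu]_x (g x * W p f x).
Proof.
move=> Lf Lg.
have Lt := integrable_phase_kernel p Lf Lg.
have /= E := Rintegral_swap Lt.
transitivity (\int[mu]_x \int[mu]_y (f x * g y * cos (x * y + p))).
  apply: eq_Rintegral => x _.
  rewrite -RintegralZl//; last exact: L1_mul_cos.
  by apply: eq_Rintegral => y _; rewrite mulrA.
rewrite E; apply: eq_Rintegral => y _.
rewrite -RintegralZl//; last exact: L1_mul_cos.
by apply: eq_Rintegral => x _; rewrite mulrA (mulrC (g y)) (mulrC y).
Qed.

(** The product is the inner integral of the jointly integrable phase kernel. *)
Lemma L1_mul_phase_transform p f g : L1 f -> L1 g -> L1 (fun x => f x * W p g x).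
Proof.
move=> Lf Lg.
have Lt := integrable_phase_kernel p Lf Lg.
have /= := L1_inner Lt.
congr L1; apply/funext => x.
rewrite /phase_transform -RintegralZl//; last exact: L1_mul_cos.
by apply: eq_Rintegral => y _; rewrite mulrA.
Qed.

Lemma is_derive_mull (a x : R) : is_derive x 1 (fun y : R => a * y) a.
Proof.
by apply: is_derive_eq; rewrite ?scaler0 ?addr0 ?add0r /GRing.scale /= ?mulr1.
Qed.

(** The sign of the derivative of the cosine is absorbed in the phase shift by
pi/2. *)
Lemma is_derive_cos_affine (a p x : R) :
  is_derive x 1 (fun y : R => cos (a * y + p)) (a * cos (a * x + (p + pi / 2))).
Proof.
rewrite addrA cosDpihalf.
have dy := is_derive_mull a x.
by apply: is_derive_eq; ring.
Qed.

(** Differentiation under the integral sign, dominated by |x u(x)|. *)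
Lemma phase_transform_derive p u xi : L1 u -> L1 (fun x => x * u x) ->
  is_derive xi 1 (W p u) (W (p + pi / 2) (fun x => x * u x) xi).
Proof.
move=> Lu Lxu.
pose f (y x : R) := u x * cos (y * x + p).
have df (y x : R) : is_derive y 1 (f ^~ x) (x * u x * cos (y * x + (p + pi / 2))).
  have := is_derive_cos_affine x p y.
  under eq_fun do rewrite mulrC.
  move=> D; rewrite /f; apply: is_derive_eq.
  by rewrite /GRing.scale /= (mulrC x y); ring.
have Ixi : `]xi - 1, xi + 1[%classic xi by rewrite /= in_itv/=; lra.
have intf x : `]xi - 1, xi + 1[%classic x -> mu.-integrable setT (EFin \o f x).
  by move=> _; exact: L1_mul_cos.
have derf y x : `]xi - 1, xi + 1[%classic y -> setT x -> derivable (f ^~ x) y 1.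
  by move=> _ _; exact: (@ex_derive _ _ _ _ _ _ _ (df y x)).
have d1fE y x : partial1of2 f y x = x * u x * cos (y * x + (p + pi / 2)).
  by rewrite partial1of2E; exact: (@derive_val _ _ _ _ _ _ _ (df y x)).
have ub y x : `]xi - 1, xi + 1[%classic y -> setT x ->
    `|partial1of2 f y x| <= `|x * u x|.
  move=> _ _; rewrite d1fE normrM -[leRHS]mulr1 ler_wpM2l//; exact: cos_max.
apply: DeriveDef.
  exact: (@derivable_under_integral _ _ _ mu f setT measurableT xi _ _ Ixi intf
    derf (fun x => `|x * u x|) (fun x => normr_ge0 _) (integrable_norm Lxu) ub).
rewrite -derive1E.
have -> := (@differentiation_under_integral _ _ _ mu f setT measurableT xi _ _ Ixi intf
    derf (fun x => `|x * u x|) (fun x => normr_ge0 _) (integrable_norm Lxu) ub).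
by apply: eq_Rintegral => x _; rewrite d1fE.
Qed.

(** Integration by parts: the difference of the two integrands is the
derivative of u(x) cos(xi x + p + pi/2), which decays at infinity. *)
Lemma phase_transform_parts p u u' xi (M : R) :
  (forall x : R, is_derive x 1 u (u' x)) -> continuous u' -> L1 u -> L1 u' ->
  (forall x, `|x * u x| <= M) ->
  xi * W p u xi = W (p + pi / 2) u' xi.
Proof.
move=> du cu' Lu Lu' uM.
have cu : continuous u.
  move=> x; apply: differentiable_continuous; apply/derivable1_diffP.
  exact: (@ex_derive _ _ _ _ _ _ _ (du x)).
(* This is u(x) times -sin(xi x + p), the boundary term of the integration by parts. *)
pose F x := u x * cos (xi * x + (p + pi / 2)).
pose f x := u' x * cos (xi * x + (p + pi / 2)) - xi * (u x * cos (xi * x + p)).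
have dF (x : R) : is_derive x 1 F (f x).
  have D1 := du x; have D2 := is_derive_cos_affine xi (p + pi / 2) x.
  rewrite /F; apply: is_derive_eq.
  rewrite /f /GRing.scale /= !addrA cosDpihalf sinDpihalf cosDpihalf; ring.
have L1a := L1_mul_cos (p + pi / 2) xi Lu'.
have L1b := L1_mul_cos p xi Lu.
have : \int[mu]_x f x = 0.
  apply: (integral_derivative_eq0 (F := F) (M := M)) => //.
  - move=> x; apply: cvgB.
      by apply: cvgM; [exact: cu'|exact: continuous_cos_affine].
    apply: cvgM; first exact: cvg_cst.
    by apply: cvgM; [exact: cu|exact: continuous_cos_affine].
  - by apply: L1_sub => //; exact: L1_scale.
  - move=> x; rewrite /F mulrA normrM -[leRHS]mulr1 ler_pM//; exact: cos_max.
rewrite /f RintegralB//; last exact: (L1_scale xi L1b).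
by rewrite RintegralZl// => /eqP; rewrite subr_eq0 => /eqP.
Qed.

End PhaseTransform.

(** * Real Schwartz functions *)

(** The Schwartz class of real-valued functions: one bound for each seminorm,
without uniformity in j and k. *)
Definition real_schwartz {R : realType} (u : R -> R) : Prop :=
  (forall (k : nat) (x : R), derivable (derive1n k u) x 1) /\
  (forall j k : nat, exists M : R, forall x, `|x ^+ j * derive1n k u x| <= M).

Section RealSchwartz.
Context {R : realType}.
Local Notation mu := (@lebesgue_measure R).
Local Notation L1 := (@integrable_on_R R).
Local Notation W := (@phase_transform R).
Implicit Types (f g u v : R -> R) (p q xi : R).

Lemma one_plus_sqr_gt0 (x : R) : 0 < 1 + x ^+ 2.
Proof. by rewrite ltr_pwDl// sqr_ge0. Qed.

Lemma continuous_inv1Dsqr : continuous (fun x : R => (1 + x ^+ 2)^-1).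
Proof.
move=> x; apply: cvgV; first by rewrite gt_eqF// one_plus_sqr_gt0.
by apply: cvgD; [exact: cvg_cst|exact: exprn_continuous].
Qed.

Lemma integral_inv1Dsqr : (\int[mu]_x ((1 + x ^+ 2)^-1)%:E = (pi : R)%:E)%E.
Proof.
rewrite ge0_symfun_integralT.
- rewrite -set_itvcy (@ge0_continuous_FTC2y _ _ atan 0 (pi / 2)).
  + by rewrite atan0 sube0 -EFinM; congr EFin; field.
  + by move=> x _; rewrite invr_ge0 ltW// one_plus_sqr_gt0.
  + by apply: continuous_subspaceT; exact: continuous_inv1Dsqr.
  + exact: cvgy_atan.
  + by move=> x _; exact: derivable_atan.
  + by apply: cvg_at_right_filter; exact: continuous_atan.
  + by move=> x _; exact: derive1_atan.
- by move=> x; rewrite invr_ge0 ltW// one_plus_sqr_gt0.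
- exact: continuous_inv1Dsqr.
- by move=> x /=; rewrite sqrrN.
Qed.

Lemma L1_inv1Dsqr : L1 (fun x => (1 + x ^+ 2)^-1).
Proof.
apply/integrableP; split.
  by apply/measurable_EFinP; apply: continuous_measurable_fun; exact: continuous_inv1Dsqr.
under eq_integral do rewrite /= ger0_norm ?invr_ge0 ?(ltW (one_plus_sqr_gt0 _))//.
by rewrite integral_inv1Dsqr ltry.
Qed.

Lemma real_schwartz_continuous u : real_schwartz u -> continuous u.
Proof.
move=> [du _] x; apply: differentiable_continuous; apply/derivable1_diffP.
exact: (du 0%N x).
Qed.

Lemma real_schwartz_derive u : real_schwartz u -> real_schwartz (derive1 u).
Proof.
move=> [du bu]; split=> [k x|j k]; first by rewrite -derive1Sn.
by have [M uM] := bu j k.+1; exists M => x; rewrite -derive1Sn.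
Qed.

Lemma real_schwartz_derive1n k u : real_schwartz u -> real_schwartz (derive1n k u).
Proof.
by move=> su; elim: k => [//|k IHk]; rewrite derive1nS; exact: real_schwartz_derive.
Qed.

Lemma real_schwartz_is_derive u (x : R) : real_schwartz u ->
  is_derive x 1 u (derive1 u x).
Proof.
by move=> [du _]; apply: DeriveDef; [exact: (du 0%N)|rewrite derive1E].
Qed.

Lemma real_schwartz_bounded u : real_schwartz u -> exists M, forall x, `|u x| <= M.
Proof.
by move=> [_ /(_ 0%N 0%N)[M uM]]; exists M => x; have := uM x; rewrite expr0 mul1r.
Qed.

(** Boundedness of u and of x^2 u bounds u by a multiple of 1/(1 + x^2). *)
Lemma real_schwartz_L1 u : real_schwartz u -> L1 u.
Proof.
move=> su; have cu := real_schwartz_continuous su.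
have [M0 uM0] := real_schwartz_bounded su.
have [_ /(_ 2%N 0%N)[M2 uM2]] := su.
(* |u| <= M0 and x^2 |u| <= M2 add up to (1 + x^2) |u| <= M0 + M2. *)
apply: (L1_dominated (g := fun x => (M0 + M2) * (1 + x ^+ 2)^-1)).
- exact: continuous_measurable_fun.
- by apply: L1_scale; exact: L1_inv1Dsqr.
- move=> x; rewrite [leRHS]ger0_norm; last first.
    rewrite mulr_ge0 ?invr_ge0 ?(ltW (one_plus_sqr_gt0 _))//.
    by rewrite addr_ge0 ?(le_trans _ (uM0 x)) ?(le_trans _ (uM2 x)).
  rewrite ler_pdivlMr ?one_plus_sqr_gt0// mulrDr mulr1 lerD//.
  by have := uM2 x; rewrite normrM (ger0_norm (sqr_ge0 x)) mulrC.
Qed.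

Lemma real_schwartz_ext u v : u =1 v -> real_schwartz u -> real_schwartz v.
Proof. by move=> /funext ->. Qed.

Lemma derive1n_add u v k : (forall k x, derivable (derive1n k u) x 1) ->
  (forall k x, derivable (derive1n k v) x 1) ->
  derive1n k (fun x => u x + v x) = (fun x => derive1n k u x + derive1n k v x).
Proof.
move=> du dv; elim: k => [//|k IHk].
rewrite derive1nS IHk; apply/funext => x.
rewrite !derive1nS !derive1E; exact: deriveD.
Qed.

Lemma real_schwartz_add u v : real_schwartz u -> real_schwartz v ->
  real_schwartz (fun x => u x + v x).
Proof.
move=> [du bu] [dv bv]; split=> [k x|j k]; rewrite derive1n_add//.
  exact: derivableD.
have [M uM] := bu j k; have [N vN] := bv j k.
exists (M + N) => x; rewrite mulrDr (le_trans (ler_normD _ _))// lerD//.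
Qed.

Lemma derive1n_scale (c : R) u k : (forall k x, derivable (derive1n k u) x 1) ->
  derive1n k (fun x => c * u x) = (fun x => c * derive1n k u x).
Proof.
move=> du; elim: k => [//|k IHk].
rewrite derive1nS IHk; apply/funext => x.
by rewrite derive1nS !derive1E; exact: (deriveZ c (du k x)).
Qed.

Lemma real_schwartz_scale (c : R) u : real_schwartz u ->
  real_schwartz (fun x => c * u x).
Proof.
move=> [du bu]; split=> [k x|j k]; rewrite derive1n_scale//.
  by apply: derivableM => //; exact: derivable_cst.
have [M uM] := bu j k.
by exists (`|c| * M) => x; rewrite mulrCA normrM ler_wpM2l.
Qed.

(** Leibniz' rule. For k = 0 the truncated index k.-1 is harmless, as its
coefficient vanishes. *)
Lemma derive1n_mulX u k : (forall k x, derivable (derive1n k u) x 1) ->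
  derive1n k (fun x => x * u x) =
  (fun x => x * derive1n k u x + k%:R * derive1n k.-1 u x).
Proof.
move=> du; elim: k => [|k IHk]; first by apply/funext => x; rewrite mul0r addr0.
rewrite derive1nS IHk; apply/funext => x.
have D (j : nat) : is_derive x 1 (derive1n j u) (derive1n j.+1 u x).
  by apply: DeriveDef => //; rewrite derive1nS derive1E.
have Dk := D k.
have Dk1 : is_derive x 1 (fun x => k%:R * derive1n k.-1 u x) (k%:R * derive1n k u x).
  case: k {IHk Dk} => [|k].
    have -> : (fun x : R => 0%:R * derive1n 0.-1 u x) = cst 0.
      by apply/funext => y; rewrite mul0r.
    by rewrite mul0r; exact: is_derive_cst.
  have Dk := D k; rewrite /=.
  by apply: is_derive_eq; rewrite /GRing.scale.
rewrite derive1E; apply: derive_val.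
apply: is_derive_eq; rewrite /GRing.scale /= -(natr1 k); ring.
Qed.

Lemma real_schwartz_mulX u : real_schwartz u -> real_schwartz (fun x => x * u x).
Proof.
move=> [du bu]; split=> [k x|j k]; rewrite derive1n_mulX//.
  apply: derivableD; first by apply: derivableM.
  by apply: derivableM => //; exact: derivable_cst.
have [M uM] := bu j.+1 k; have [N vN] := bu j k.-1.
exists (M + k%:R * N) => x; rewrite mulrDr (le_trans (ler_normD _ _))// lerD//.
  by rewrite mulrA -exprSr.
by rewrite mulrCA normrM ger0_norm// ler_wpM2l.
Qed.

Lemma real_schwartz_mulXn u k : real_schwartz u ->
  real_schwartz (fun x => x ^+ k * u x).
Proof.
move=> su; elim: k => [|k IHk].
  by apply: real_schwartz_ext su => x; rewrite expr0 mul1r.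
apply: real_schwartz_ext (real_schwartz_mulX IHk) => x.
by rewrite mulrA -exprS.
Qed.

Lemma derive1n_phase_transform p u k : real_schwartz u ->
  derive1n k (W p u) = W (p + k%:R * (pi / 2)) (fun x => x ^+ k * u x).
Proof.
move=> su; elim: k => [|k IHk].
  rewrite /= mul0r addr0; congr W.
  by apply/funext => x; rewrite expr0 mul1r.
rewrite derive1nS IHk; apply/funext => x.
have sk := real_schwartz_mulXn k su.
have D := phase_transform_derive (p + k%:R * (pi / 2)) x
  (real_schwartz_L1 sk) (real_schwartz_L1 (real_schwartz_mulX sk)).
rewrite derive1E (@derive_val _ _ _ _ _ _ _ D).
have -> : p + k.+1%:R * (pi / 2) = p + k%:R * (pi / 2) + pi / 2.
  by rewrite -(natr1 k); ring.
congr W.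
by apply/funext => y; rewrite exprS mulrA.
Qed.

Lemma phase_transform_mulXn p u j xi : real_schwartz u ->
  xi ^+ j * W p u xi = W (p + j%:R * (pi / 2)) (derive1n j u) xi.
Proof.
move=> su; elim: j => [|j IHj]; first by rewrite mul0r addr0 expr0 mul1r.
have sj := real_schwartz_derive1n j su.
have sj' := real_schwartz_derive sj.
have [_ /(_ 1%N 0%N)[M uM]] := sj.
rewrite exprS -mulrA IHj.
have uM1 x : `|x * derive1n j u x| <= M by have := uM x; rewrite expr1.
rewrite (@phase_transform_parts _ _ _ _ _ M
  (fun x => real_schwartz_is_derive x sj) (real_schwartz_continuous sj')
  (real_schwartz_L1 sj) (real_schwartz_L1 sj') uM1).
by rewrite derive1nS; congr W; rewrite -(natr1 j); ring.
Qed.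

(** Up to the phase, x^j times the k-th derivative of W p u is the transform
of the j-th derivative of x^k u, and a transform is bounded by the L1 norm. *)
Lemma real_schwartz_phase_transform p u : real_schwartz u -> real_schwartz (W p u).
Proof.
move=> su; split=> [k x|j k]; rewrite derive1n_phase_transform//.
  have sk := real_schwartz_mulXn k su.
  have [+ _] := phase_transform_derive (p + k%:R * (pi / 2)) x
    (real_schwartz_L1 sk) (real_schwartz_L1 (real_schwartz_mulX sk)).
  by [].
have sk := real_schwartz_mulXn k su.
exists (\int[mu]_x `|derive1n j (fun x => x ^+ k * u x) x|) => x.
rewrite phase_transform_mulXn//; apply: phase_transform_bound.
exact/real_schwartz_L1/real_schwartz_derive1n.
Qed.

End RealSchwartz.

(** * Fourier inversion *)

Section Inversion.
Context {R : realType}.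
Local Notation mu := (@lebesgue_measure R).
Local Notation L1 := (@integrable_on_R R).
Local Notation W := (@phase_transform R).
Implicit Types (f g u v : R -> R) (p q xi : R).

(** The convergence factor exp(-e|x|), whose transform is elementary. *)
Definition two_sided_exp (e x : R) : R := expR (- (e * `|x|)).

Lemma continuous_two_sided_exp e : continuous (two_sided_exp e).
Proof.
move=> x; apply: continuous_comp; last exact: continuous_expR.
by apply: cvgN; apply: cvgM; [exact: cvg_cst|exact: norm_continuous].
Qed.

Lemma is_derive_expR_linear (e x : R) :
  is_derive x 1 (fun y : R => expR (- (e * y))) (- e * expR (- (e * x))).
Proof.
have dy := is_derive_mull e x.
by apply: is_derive_eq; ring.
Qed.

Lemma expR_decay (e : R) (n : nat) : 0 < e -> expR (- (e * n.+1%:R)) <= e^-1 / n.+1%:R.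
Proof.
move=> e0; rewrite expRN -invfM lef_pV2 ?posrE ?expR_gt0 ?mulr_gt0 ?ltr0Sn//.
by apply: (le_trans _ (expR_ge1Dx _)); rewrite lerDr.
Qed.

Lemma cvg_expR_linear (e : R) : 0 < e ->
  expR (- (e * n.+1%:R)) @[n --> \oo] --> (0 : R).
Proof.
move=> e0; apply: (@squeeze_cvgr _ _ _ _ (cst 0) (fun n => e^-1 / n.+1%:R)).
- by near=> n; rewrite expR_ge0 expR_decay.
- exact: cvg_cst.
- exact: cvg_const_div_nat.
Unshelve. all: end_near. Qed.

Lemma L1_two_sided_exp e : 0 < e -> L1 (two_sided_exp e).
Proof.
move=> e0; apply/integrableP; split.
  by apply/measurable_EFinP; apply: continuous_measurable_fun; exact: continuous_two_sided_exp.
under eq_integral do rewrite /= ger0_norm ?expR_ge0//.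
rewrite ge0_symfun_integralT; last 3 first.
- by move=> x; exact: expR_ge0.
- exact: continuous_two_sided_exp.
- by move=> x /=; rewrite /two_sided_exp normrN.
rewrite -set_itvcy.
under eq_integral => x.
  rewrite inE /= in_itv/= andbT => x0; rewrite /two_sided_exp ger0_norm//; over.
pose F (y : R) := - e^-1 * expR (- (e * y)).
have dF (x : R) : is_derive x 1 F (expR (- (e * x))).
  have D := is_derive_expR_linear e x; rewrite /F.
  apply: is_derive_eq; rewrite /GRing.scale /=; field; exact: lt0r_neq0.
rewrite (@ge0_continuous_FTC2y _ _ F 0 0).
- by rewrite -EFinB -EFinM ltry.
- by move=> x _; exact: expR_ge0.
- apply: continuous_subspaceT => x; apply: differentiable_continuous.
  apply/derivable1_diffP; have D := is_derive_expR_linear e x; exact: ex_derive.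
- rewrite -[X in _ --> X](mulr0 (- e^-1)); apply: cvgM; first exact: cvg_cst.
  apply: (cvg_comp (fun x => e * x) (fun x => expR (- x))); last exact: cvgr_expR.
  exact: gt0_cvgMry.
- by move=> x _; exact: (@ex_derive _ _ _ _ _ _ _ (dF x)).
- apply: cvg_at_right_filter; apply: differentiable_continuous.
  by apply/derivable1_diffP; exact: (@ex_derive _ _ _ _ _ _ _ (dF 0)).
- by move=> x _; rewrite derive1E; exact: (@derive_val _ _ _ _ _ _ _ (dF x)).
Qed.

(** The integrand is even, and on the positive half-line it has an explicit
primitive. *)
Lemma phase_transform_two_sided_exp e xi : 0 < e ->
  W 0 (two_sided_exp e) xi = 2 * e / (e ^+ 2 + xi ^+ 2).
Proof.
move=> e0; have LK := L1_two_sided_exp e0.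
have LKc := L1_mul_cos 0 xi LK.
have D0 : 0 < e ^+ 2 + xi ^+ 2 by rewrite ltr_pwDl ?sqr_ge0// exprn_gt0.
rewrite /phase_transform integral_even//; last first.
  by move=> x; rewrite /two_sided_exp normrN mulrN !addr0 cosN.
rewrite -mulrA; congr (2 * _).
pose f x := expR (- (e * x)) * cos (xi * x).
(* This primitive is the real part of exp((-e + i xi) x) / (-e + i xi). *)
pose F x := expR (- (e * x)) * (xi * sin (xi * x) - e * cos (xi * x)) / (e ^+ 2 + xi ^+ 2).
have fE x : `[0, +oo[%classic x -> two_sided_exp e x * cos (xi * x + 0) = f x.
  by rewrite /= in_itv/= andbT /two_sided_exp /f addr0 => x0; rewrite ger0_norm.
transitivity (\int[mu]_(x in `[0, +oo[) f x).
  by apply: eq_Rintegral => x; rewrite inE => /fE.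
have dexp (x : R) := is_derive_expR_linear e x.
have dmul (x : R) := is_derive_mull xi x.
apply: (@FTC_exhaustion _ _ F f (fun=> 0) (fun n => n.+1%:R)) => //.
- by move=> n; apply: subset_itvl.
- move=> x; rewrite /= in_itv/= andbT => x0; near=> n; rewrite x0/=.
  have : x < n%:R by near: n; exact: nbhs_infty_gtr.
  by move/ltW/le_trans; apply; rewrite ler_nat.
- move=> x; apply: differentiable_continuous; apply/derivable1_diffP.
  have dm := dmul x; have de := dexp x; exact: ex_derive.
- move=> x; have dm := dmul x; have de := dexp x; rewrite /F.
  apply: is_derive_eq; rewrite /f /GRing.scale /=; field; exact: lt0r_neq0.
- apply: (@eq_integrable _ _ _ mu _ _
    (EFin \o (fun x => two_sided_exp e x * cos (xi * x + 0)))) => //.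
    by move=> x; rewrite inE => /fE /= ->.
  exact: (@integrableS _ _ _ mu _ _ _ measurableT _ (@subsetT _ _) LKc).
- have -> : e / (e ^+ 2 + xi ^+ 2) = 0 - F 0.
    rewrite /F !mulr0 oppr0 expR0 sin0 cos0; field; exact: lt0r_neq0.
  apply: cvgB; last exact: cvg_cst.
  apply: norm_cvg0.
  apply: (@squeeze_cvgr _ _ _ _ (cst 0) (fun n => expR (- (e * n.+1%:R)) *
    ((`|xi| + e) / (e ^+ 2 + xi ^+ 2)))).
  + near=> n; rewrite normr_ge0 /= /F !normrM (ger0_norm (expR_ge0 _)) -mulrA.
    rewrite ler_wpM2l ?expR_ge0// ler_pM//.
      rewrite (le_trans (ler_normB _ _))// !normrM lerD//.
        by rewrite -[leRHS]mulr1 ler_wpM2l// sin_max.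
      by rewrite (gtr0_norm e0) -[leRHS]mulr1 ler_wpM2l ?(ltW e0)// cos_max.
    by rewrite ger0_norm ?invr_ge0 ?(ltW D0).
  + exact: cvg_cst.
  + rewrite -[X in _ --> X](mul0r ((`|xi| + e) / (e ^+ 2 + xi ^+ 2))).
    by apply: cvgM; [exact: cvg_expR_linear|exact: cvg_cst].
Unshelve. all: end_near. Qed.

(** Fourier inversion at the origin. By self-adjointness, integrating W 0 v
against exp(-e|x|) is integrating v against the Poisson kernel
2e/(e^2 + x^2); rescaled by e, this is v(e z) against 2/(1 + z^2), whose total
mass is 2 pi. Dominated convergence applies on both sides as e tends to 0. *)
Lemma integral_phase_transform v (M : R) : L1 v -> continuous v ->
  (forall x, `|v x| <= M) -> L1 (W 0 v) ->
  \int[mu]_x W 0 v x = 2 * pi * v 0.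
Proof.
move=> Lv cv vM LWv.
pose e (n : nat) : R := n.+1%:R^-1.
have e0 n : 0 < e n by rewrite invr_gt0 ltr0Sn.
have ecvg : e n @[n --> \oo] --> (0 : R) by exact: cvg_harmonic.
have mv := L1_measurable Lv.
have poissonE n : \int[mu]_x (two_sided_exp (e n) x * W 0 v x) =
    \int[mu]_z (v (e n * z) * (2 * (1 + z ^+ 2)^-1)).
  have LK := L1_two_sided_exp (e0 n).
  rewrite phase_transform_selfadjoint//.
  have Lvk := L1_mul_phase_transform 0 Lv LK.
  have [_ ->] := integral_affine 0 (e0 n) Lvk.
  have [L' _] := integral_affine 0 (e0 n) Lvk.
  rewrite -RintegralZl//; apply: eq_Rintegral => z _.
  rewrite add0r phase_transform_two_sided_exp//.
  have h1 : 1 + z ^+ 2 != 0 by rewrite gt_eqF// one_plus_sqr_gt0.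
  have h2 : e n != 0 by rewrite gt_eqF.
  have -> : e n ^+ 2 + (e n * z) ^+ 2 = e n ^+ 2 * (1 + z ^+ 2) by ring.
  by move: (e n) h2 => c h2; field; rewrite h1.
have lhs : \int[mu]_x (two_sided_exp (e n) x * W 0 v x) @[n --> \oo]
    --> \int[mu]_x W 0 v x.
  apply: (Rintegral_dominated_cvg (g := fun x => `|W 0 v x|)) => //.
  - move=> n; apply: measurable_funM; last exact: L1_measurable.
    by apply: continuous_measurable_fun; exact: continuous_two_sided_exp.
  - exact: L1_measurable.
  - move=> x _; rewrite -[X in _ --> X]mul1r; apply: cvgM; last exact: cvg_cst.
    rewrite -expR0; apply: continuous_cvg; first exact: continuous_expR.
    rewrite -oppr0; apply: cvgN; rewrite -(mul0r `|x|); apply: cvgM => //; exact: cvg_cst.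
  - exact: (L1_norm LWv).
  - move=> n x _; rewrite normrM ger0_norm ?expR_ge0// -[leRHS]mul1r ler_wpM2r//.
    by rewrite -expR0 ler_expR oppr_le0 mulr_ge0// ltW.
have rhs : \int[mu]_z (v (e n * z) * (2 * (1 + z ^+ 2)^-1)) @[n --> \oo]
    --> \int[mu]_z (v 0 * (2 * (1 + z ^+ 2)^-1)).
  have cQ : continuous (fun z : R => 2 * (1 + z ^+ 2)^-1).
    by move=> z; apply: cvgM; [exact: cvg_cst|exact: continuous_inv1Dsqr].
  have LQ : L1 (fun z => 2 * (1 + z ^+ 2)^-1) by apply: L1_scale; exact: L1_inv1Dsqr.
  have mQ := L1_measurable LQ.
  apply: (Rintegral_dominated_cvg (g := fun z => M * (2 * (1 + z ^+ 2)^-1))) => //.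
  - move=> n; apply: measurable_funM => //; apply: (measurableT_comp mv).
    exact: measurable_funM.
  - exact: measurable_funM.
  - move=> z _; apply: cvgM; last exact: cvg_cst.
    apply: continuous_cvg; first exact: cv.
    by rewrite -(mul0r z); apply: cvgM => //; exact: cvg_cst.
  - exact: (L1_scale M LQ).
  - move=> n z _; rewrite normrM ler_pM//.
    by rewrite ger0_norm// mulr_ge0// invr_ge0 ltW// one_plus_sqr_gt0.
move: lhs; rewrite (funext poissonE) => lhs; rewrite (cvg_unique _ lhs rhs)//.
rewrite RintegralZl//; last by exact: (L1_scale 2 L1_inv1Dsqr).
rewrite RintegralZl//; last by exact: L1_inv1Dsqr.
have -> : \int[mu]_z (1 + z ^+ 2)^-1 = pi :> R by rewrite /Rintegral integral_inv1Dsqr.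
by ring.
Qed.


Lemma phase_transform_sin u xi :
  W (- (pi / 2)) u xi = \int[mu]_x (u x * sin (xi * x)).
Proof. by apply: eq_Rintegral => x _; rewrite cosBpihalf. Qed.

(** Expand the cosine in cos(x (s - xi)), where s = xi + y. *)
Lemma phase_transform_translate u xi x : L1 u ->
  W 0 (fun y => u (xi + y)) x = cos (xi * x) * W 0 u x + sin (xi * x) * W (- (pi / 2)) u x.
Proof.
move=> Lu.
have L0 := L1_mul_cos (- (x * xi)) x Lu.
have [_] := integral_translate xi L0.
have -> : \int[mu]_y (u (xi + y) * cos (x * (xi + y) - x * xi)) = W 0 (fun y => u (xi + y)) x.
  by apply: eq_Rintegral => y _; rewrite addr0 mulrDr [x * xi + _]addrC addrK.
move=> ->; rewrite -RintegralZl//; last exact: L1_mul_cos.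
rewrite -RintegralZl//; last exact: L1_mul_cos.
rewrite -RintegralD//; [|exact/L1_scale/L1_mul_cos..].
by apply: eq_Rintegral => y _; rewrite addr0 cosBpihalf cosB (mulrC xi); ring.
Qed.

(** By the translation formula the left-hand side is the integral of
W 0 v for the translate v(y) = u(xi + y), so this is inversion at the
origin for v. *)
Lemma phase_transform_inversion u xi : real_schwartz u ->
  W 0 (W 0 u) xi + W (- (pi / 2)) (W (- (pi / 2)) u) xi = 2 * pi * u xi.
Proof.
move=> su; have Lu := real_schwartz_L1 su.
have L0 := real_schwartz_L1 (real_schwartz_phase_transform 0 su).
have L2 := real_schwartz_L1 (real_schwartz_phase_transform (- (pi / 2)) su).
have [M uM] := real_schwartz_bounded su.
have [Lv _] := integral_translate xi Lu.
have E : W 0 (fun y => u (xi + y)) = (fun x => W 0 u x * cos (xi * x + 0) +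
    W (- (pi / 2)) u x * cos (xi * x - pi / 2)).
  apply/funext => x; rewrite phase_transform_translate// addr0 cosBpihalf.
  by rewrite mulrC [X in _ + X]mulrC.
have L0c := L1_mul_cos 0 xi L0.
have L2c := L1_mul_cos (- (pi / 2)) xi L2.
rewrite -[in RHS](addr0 xi) -(@integral_phase_transform (fun y => u (xi + y)) M)//.
- by rewrite E RintegralD.
- move=> x; apply: continuous_comp; last exact: real_schwartz_continuous.
  by apply: cvgD; [exact: cvg_cst|exact: cvg_id].
- by rewrite E; apply: L1_add.
Qed.

(** The difference of the two sides is the integral of
sin(xi x) W 0 u (x) - cos(xi x) W (-pi/2) u (x), an odd function of x. This is
what makes the imaginary part of the inversion formula vanish. *)
Lemma phase_transform_commute u xi : real_schwartz u ->
  W (- (pi / 2)) (W 0 u) xi = W 0 (W (- (pi / 2)) u) xi.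
Proof.
move=> su; have Lu := real_schwartz_L1 su.
have L0 := real_schwartz_L1 (real_schwartz_phase_transform 0 su).
have L2 := real_schwartz_L1 (real_schwartz_phase_transform (- (pi / 2)) su).
have L0c := L1_mul_cos (- (pi / 2)) xi L0.
have L2c := L1_mul_cos 0 xi L2.
apply/eqP; rewrite -subr_eq0; apply/eqP.
rewrite /(W _ _ xi) /phase_transform -RintegralB//.
apply: integral_odd; first exact: L1_sub.
have e0 x : W 0 u (- x) = W 0 u x.
  by apply: eq_Rintegral => y _; rewrite !addr0 mulNr cosN.
have e1 x : W (- (pi / 2)) u (- x) = - W (- (pi / 2)) u x.
  rewrite !phase_transform_sin -[RHS]mulN1r -RintegralZl//.
    by apply: eq_Rintegral => y _; rewrite mulNr sinN; ring.
  by have := L1_mul_cos (- (pi / 2)) x Lu; under eq_fun do rewrite cosBpihalf.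
move=> x; rewrite -!/(phase_transform _ _ _) e0 e1 !addr0 !cosBpihalf mulrN sinN cosN; ring.
Qed.

End Inversion.

(** * Transforms of B-splines *)

Section BSplineTransform.
Context {R : realType}.
Local Notation mu := (@lebesgue_measure R).
Local Notation L1 := (@integrable_on_R R).
Local Notation W := (@phase_transform R).
Implicit Types (f g u v : R -> R) (p q xi : R).

(** By translation invariance the iterated integral of the absolute value is
at most the product of the two L1 norms. *)
Lemma integrable_convolution_kernel f g (h : R * R -> R) : L1 f -> L1 g ->
  measurable_fun setT h -> (forall z, `|h z| <= 1) ->
  (mu \x mu)%E.-integrable setT
    (EFin \o (fun z => f (z.1 - z.2) * g z.2 * h z)).
Proof.
move=> Lf Lg mh h1.
have mf := L1_measurable Lf; have mg := L1_measurable Lg.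
have mfg : measurable_fun setT (fun z : R * R => f (z.1 - z.2) * g z.2).
  apply: measurable_funM; last exact: measurableT_comp.
  by apply: (measurableT_comp mf); apply: measurable_funB.
have Lfg : (mu \x mu)%E.-integrable setT (EFin \o (fun z => f (z.1 - z.2) * g z.2)).
  apply/integrable21ltyP; first exact/measurable_EFinP.
  have inner t : (\int[mu]_x `|(f (x - t) * g t)%:E| = (\int[mu]_x `|f x|)%:E * `|(g t)%:E|)%E.
    have [Lt Et] := integral_translate (- t) (L1_norm Lf).
    under eq_integral do rewrite /= normrM EFinM.
    rewrite ge0_integralZr//; last first.
      apply/measurable_EFinP; apply: measurableT_comp => //; apply: (measurableT_comp mf).
      exact: measurable_funB.
    congr (_ * _)%E; rewrite -Et /Rintegral fineK; last exact: (integrable_fin_num measurableT Lt).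
    by apply: eq_integral => x _; rewrite addrC.
  under eq_integral => t _ do rewrite /= inner.
  have /integrableP[mG iG] := Lg.
  rewrite ge0_integralZl//=.
  - by apply: lte_mul_pinfty => //; rewrite lee_fin; exact: Rintegral_ge0.
  - by apply/measurable_EFinP; apply: measurableT_comp.
  - by rewrite lee_fin; exact: Rintegral_ge0.
apply: (@le_integrable _ _ _ (mu \x mu)%E _ measurableT _
  (EFin \o (fun z : R * R => f (z.1 - z.2) * g z.2))).
- by apply/measurable_EFinP; apply: measurable_funM.
- move=> z _; rewrite /= lee_fin normrM -[leRHS]mulr1; exact: ler_wpM2l.
- exact: Lfg.
Qed.

Lemma L1_convolution f g : L1 f -> L1 g -> L1 (convolution f g).
Proof.
move=> Lf Lg.
have h1 (z : R * R) : `|(cst 1 : R * R -> R) z| <= 1 by rewrite normr1.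
have K := integrable_convolution_kernel Lf Lg (measurable_cst _) h1.
have := L1_inner K; congr L1; apply/funext => x.
by apply: eq_Rintegral => t _; rewrite /= mulr1.
Qed.

(** With one factor bounded, the integral defining the convolution converges at
every point and not merely almost everywhere. *)
Lemma L1_reflected_mul f g (C : R) x : L1 f -> (forall x, `|f x| <= C) -> L1 g ->
  L1 (fun t => f (x - t) * g t).
Proof.
move=> Lf fC Lg; under eq_fun do rewrite mulrC.
apply: (L1_mul_bounded (C := C)) => //.
by apply: (measurableT_comp (L1_measurable Lf)); apply: measurable_funB.
Qed.

Lemma convolution_bounded f g (C : R) : L1 f -> (forall x, `|f x| <= C) -> L1 g ->
  forall x, `|convolution f g x| <= (\int[mu]_t `|g t|) * C.
Proof.
move=> Lf fC Lg x.
have -> : convolution f g x = \int[mu]_t (g t * f (x - t)).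
  by apply: eq_Rintegral => t _; rewrite mulrC.
apply: integral_bound => //.
by apply: (measurableT_comp (L1_measurable Lf)); apply: measurable_funB.
Qed.

(** Fubini's theorem, followed by the translation x - t = s: the shift of
the variable becomes a shift of the phase by xi t. *)
Lemma phase_transform_convolution f g (C : R) p xi : L1 f ->
  (forall x, `|f x| <= C) -> L1 g ->
  W p (convolution f g) xi = \int[mu]_t (g t * W (p + xi * t) f xi).
Proof.
move=> Lf fC Lg.
have mcos : measurable_fun setT (fun z : R * R => cos (xi * z.1 + p)).
  exact: (measurableT_comp (measurable_cos_affine xi p)).
have K := integrable_convolution_kernel Lf Lg mcos (fun z => cos_max _).
transitivity (\int[mu]_x \int[mu]_t (f (x - t) * g t * cos (xi * x + p))).
  apply: eq_Rintegral => x _; rewrite RintegralZr//.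
  exact: (L1_reflected_mul x Lf fC Lg).
rewrite (Rintegral_swap K); apply: eq_Rintegral => t _ /=.
have [] := integral_translate (- t) (L1_mul_cos (p + xi * t) xi Lf).
rewrite /phase_transform => Lt <-; rewrite -RintegralZl//.
apply: eq_Rintegral => x _; rewrite mulrCA mulrA (addrC (- t)).
by congr (_ * cos _); ring.
Qed.

Lemma L1_box : L1 box.
Proof. exact: integrable_indic_itv. Qed.

Lemma box_bounded (x : R) : `|box x| <= 1.
Proof. by rewrite /box indicE; case: (_ \in _); rewrite ?normr1 ?normr0. Qed.

(** The case xi = 0 is separate because the primitive sin(xi x + p)/xi
degenerates there; this is also where sinc takes its special value. *)
Lemma phase_transform_box p xi : W p box xi = cos p * sinc (xi / 2).
Proof.
have h2 : - 2^-1 < 2^-1 :> R by lra.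
transitivity (\int[mu]_(x in `[- 2^-1, 2^-1]) cos (xi * x + p)).
  rewrite [RHS]Rintegral_mkcond; apply: eq_Rintegral => x _.
  by rewrite /box indicE /patch; case: ifP; rewrite ?mul1r ?mul0r.
have FTC (F : R -> R) : (forall x : R, is_derive x 1 F (cos (xi * x + p))) ->
    \int[mu]_(x in `[- 2^-1, 2^-1]) cos (xi * x + p) = F 2^-1 - F (- 2^-1).
  move=> dF.
  have cF x : F y @[y --> x] --> F x.
    by apply: differentiable_continuous; apply/derivable1_diffP; exact: ex_derive.
  rewrite /Rintegral (@continuous_FTC2 _ _ F _ _ h2)//.
  - by apply: continuous_subspaceT; exact: continuous_cos_affine.
  - split=> [x _||]; first exact: ex_derive.
      by apply: cvg_at_right_filter.
    by apply: cvg_at_left_filter.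
  - by move=> x _; rewrite derive1E derive_val.
rewrite /sinc mulf_eq0 invr_eq0 (negbTE (lt0r_neq0 (ltr0Sn R 1))) orbF.
case: eqP => [-> | /eqP xi0].
  under eq_Rintegral do rewrite mul0r add0r.
  rewrite Rintegral_cst//= lebesgue_measure_itv/= lte_fin h2 mulr1.
  by rewrite -[RHS]mulr1; congr (_ * _) => /=; lra.
have dF (x : R) : is_derive x 1 (fun y => sin (xi * y + p) / xi) (cos (xi * x + p)).
  have dm := is_derive_mull xi x.
  by apply: is_derive_eq; rewrite /GRing.scale /=; field.
rewrite (FTC _ dF).
by rewrite mulrN !sinD cosN sinN; field.
Qed.

Lemma bspline_L1_bounded n : L1 (bspline n) /\ exists C : R, forall x, `|bspline n x| <= C.
Proof.
elim: n => [|n [Ln [C nC]]] /=.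
  by split; [exact: L1_box|exists 1; exact: box_bounded].
split; first exact: L1_convolution Ln L1_box.
eexists; exact: (convolution_bounded Ln nC L1_box).
Qed.

Lemma L1_bspline n : L1 (bspline n).
Proof. by have [] := bspline_L1_bounded n. Qed.

(** The phase must be general for the induction: the convolution formula calls
the hypothesis at phase p + xi t, and the factor cos(p + xi t) then rebuilds
the transform of the box. *)
Lemma phase_transform_bspline n p xi :
  W p (bspline n) xi = cos p * sinc (xi / 2) ^+ n.+1.
Proof.
elim: n p => [|n IHn] p; first by rewrite /= phase_transform_box expr1.
have [Ln [C nC]] := bspline_L1_bounded n.
rewrite /= (phase_transform_convolution p xi Ln nC L1_box).
under eq_Rintegral do rewrite IHn mulrA (addrC p).
rewrite RintegralZr//; last exact: (L1_mul_cos p xi L1_box).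
by rewrite -/(phase_transform p box xi) phase_transform_box -mulrA -exprS.
Qed.

End BSplineTransform.

(** * The infinite product *)

Section InfiniteProduct.
Context {R : realType}.
Implicit Types x xi : R.

Lemma m0E xi : m0 xi = cos (xi / 2) ^+ 2.
Proof.
rewrite /m0 /G.
have -> : (xi + pi) / 2 = xi / 2 + pi / 2 by field.
by rewrite sinDpihalf sin_pihalf expr1n mulr1 mulrC mulKf.
Qed.

(** The duplication formula of the sine; it also holds at 0 with the value
filled in. *)
Lemma sinc_half x : sinc x = cos (x / 2) * sinc (x / 2).
Proof.
rewrite /sinc mulf_eq0 invr_eq0 (negbTE (lt0r_neq0 (ltr0Sn R 1))) orbF.
case: eqP => [->|/eqP x0]; first by rewrite mul0r cos0 mulr1.
have {1 2}-> : x = (x / 2) *+ 2 by rewrite mulr2n; field.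
by rewrite sin_mulr2n -[in LHS]mulr_natl -(mulr_natl (x / 2)); field.
Qed.

(** Each factor cos(xi/2^(j+1))^2 halves the argument of sinc, so the partial
product telescopes. The multiplicative form avoids dividing by a sinc that may
vanish. *)
Lemma phihat_partialP xi n :
  phihat_partial xi n * sinc (xi / 2 / 2 ^+ n) ^+ 2 = sinc (xi / 2) ^+ 2.
Proof.
elim: n => [|n IHn]; first by rewrite /phihat_partial big_geq// mul1r expr0 divr1.
rewrite -IHn /phihat_partial big_nat_recr//= -mulrA; congr (_ * _).
rewrite m0E -exprMn [in RHS]sinc_half.
have n0 : 2 ^+ n != 0 :> R by rewrite expf_neq0.
have -> : 2 ^- n.+1 * xi / 2 = xi / 2 / 2 ^+ n / 2 by rewrite exprS; field.
by have -> : xi / 2 / 2 ^+ n.+1 = xi / 2 / 2 ^+ n / 2 by rewrite exprS; field.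
Qed.

(** The quotient sin h / h is the difference quotient of the sine at 0. *)
Lemma cvg_sinc (x_ : nat -> R) : (forall n, x_ n != 0) ->
  x_ n @[n --> \oo] --> 0 -> sinc (x_ n) @[n --> \oo] --> (1 : R).
Proof.
move=> x0 xcvg.
have : h^-1 *: ((sin \o shift (0 : R)) (h *: 1) - sin 0) @[h --> (0 : R)^'] --> (1 : R).
  rewrite -[X in _ --> X](_ : 'D_1 sin 0 = 1); first exact: derivable_sin.
  by rewrite derive_val cos0.
move=> /cvgr_dnbhsP /(_ x_ (conj x0 xcvg)).
suff -> : (fun n => sinc (x_ n)) =
    (fun n => (x_ n)^-1 *: ((sin \o shift (0 : R)) (x_ n *: 1) - sin 0)) by [].
apply/funext => n /=.
by rewrite /sinc (negbTE (x0 n)) sin0 subr0 addr0 /GRing.scale /= mulr1 mulrC.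
Qed.

Lemma cvg_phihat_partial xi :
  phihat_partial xi n @[n --> \oo] --> sinc (xi / 2) ^+ 2.
Proof.
have cs : sinc (xi / 2 / 2 ^+ n) @[n --> \oo] --> (1 : R).
  have [->|xi0] := eqVneq xi 0.
    by apply: cvg_near_cst; near=> n; rewrite !mul0r /sinc eqxx.
  apply: cvg_sinc => [n|]; first by rewrite !mulf_neq0// invr_eq0 expf_neq0.
  rewrite -[X in _ --> X](mulr0 (xi / 2)); apply: cvgM; first exact: cvg_cst.
  under eq_fun do rewrite -exprVn.
  by apply: cvg_expr; rewrite ger0_norm; lra.
have cinv : sinc (xi / 2) ^+ 2 / sinc (xi / 2 / 2 ^+ n) ^+ 2 @[n --> \oo]
    --> sinc (xi / 2) ^+ 2.
  rewrite -[X in _ --> X]mulr1; apply: cvgM; first exact: cvg_cst.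
  rewrite -[X in _ --> X]invr1; apply: cvgV; first by rewrite oner_neq0.
  by rewrite -[X in _ --> X](mulr1 1); apply: cvgM.
apply: cvg_trans cinv; apply: near_eq_cvg; near=> n.
rewrite -(phihat_partialP xi n) mulfK// expf_neq0// gt_eqF//.
near: n; exact: (cvgr_gt _ cs).
Unshelve. all: end_near. Qed.

Lemma phihatE xi : phihat xi = sinc (xi / 2) ^+ 2.
Proof. by apply: cvg_lim => //; exact: cvg_phihat_partial. Qed.

End InfiniteProduct.

(** * Complex-valued functions and distributions *)

Section ComplexAssembly.
Context {R : realType}.
Local Notation mu := (@lebesgue_measure R).
Local Notation L1 := (@integrable_on_R R).
Local Notation W := (@phase_transform R).
Local Notation reP := (fun f : R -> R[i] => (fun x => complex.Re (f x))).
Local Notation imP := (fun f : R -> R[i] => (fun x => complex.Im (f x))).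
Implicit Types (f g : R -> R[i]) (b u v : R -> R) (p q xi : R).

Lemma ReD (z w : R[i]) : complex.Re (z + w) = complex.Re z + complex.Re w.
Proof. by case: z; case: w. Qed.

Lemma ImD (z w : R[i]) : complex.Im (z + w) = complex.Im z + complex.Im w.
Proof. by case: z; case: w. Qed.

Lemma ReM (z w : R[i]) :
  complex.Re (z * w) = complex.Re z * complex.Re w - complex.Im z * complex.Im w.
Proof. by case: z; case: w. Qed.

Lemma ImM (z w : R[i]) :
  complex.Im (z * w) = complex.Re z * complex.Im w + complex.Im z * complex.Re w.
Proof. by case: z; case: w. Qed.

(** cos(y - pi/2) = sin y, so phase -pi/2 provides the sine parts of
exp(-i xi x). *)
Lemma fourierE f xi : L1 (reP f) -> L1 (imP f) -> fourier f xi =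
  (W 0 (reP f) xi + W (- (pi / 2)) (imP f) xi) +i*
  (W 0 (imP f) xi - W (- (pi / 2)) (reP f) xi).
Proof.
move=> Lr Li; rewrite /fourier /cintegral; congr (_ +i* _).
  rewrite /phase_transform -RintegralD//; [|exact: L1_mul_cos..].
  apply: eq_Rintegral => x _.
  by rewrite ReM /= cosN sinN mulrN opprK addr0 cosBpihalf.
rewrite /phase_transform -RintegralB//; [|exact: L1_mul_cos..].
apply: eq_Rintegral => x _.
by rewrite ImM /= cosN sinN addr0 cosBpihalf mulrN addrC.
Qed.

Lemma normc_ge_Re (a b : R) : `|a| <= Normc.normc (a +i* b).
Proof. by rewrite /= -sqrtr_sqr ler_wsqrtr// lerDl sqr_ge0. Qed.

Lemma normc_ge_Im (a b : R) : `|b| <= Normc.normc (a +i* b).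
Proof. by rewrite /= -sqrtr_sqr ler_wsqrtr// lerDr sqr_ge0. Qed.

Lemma normc_le_ReDIm (a b : R) : Normc.normc (a +i* b) <= `|a| + `|b|.
Proof.
rewrite /= -(ger0_norm (addr_ge0 (normr_ge0 a) (normr_ge0 b))) -sqrtr_sqr.
rewrite ler_wsqrtr// sqrrD !real_normK ?num_real// mulr2n.
by have := mulr_ge0 (normr_ge0 a) (normr_ge0 b); lra.
Qed.

Lemma mulC_cderiven (c : R) k f x : c%:C * cderiven k f x =
  (c * derive1n k (reP f) x) +i* (c * derive1n k (imP f) x).
Proof. by apply/eqP; rewrite eq_complex /= !mul0r subr0 addr0 !eqxx. Qed.

Lemma schwartz_Re f : schwartz f -> real_schwartz (reP f).
Proof.
move=> [sf bf]; split=> [k x|j k]; first by have [] := sf k x.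
have [M fM] := bf (maxn j k); exists M => x.
have := fM j k x (leq_maxl _ _) (leq_maxr _ _); rewrite mulC_cderiven.
exact/le_trans/normc_ge_Re.
Qed.

Lemma schwartz_Im f : schwartz f -> real_schwartz (imP f).
Proof.
move=> [sf bf]; split=> [k x|j k]; first by have [] := sf k x.
have [M fM] := bf (maxn j k); exists M => x.
have := fM j k x (leq_maxl _ _) (leq_maxr _ _); rewrite mulC_cderiven.
exact/le_trans/normc_ge_Im.
Qed.

(** The seminorms up to order N are finitely many and nonnegative, so the sum
of their bounds bounds them all. *)
Lemma real_schwartz_uniform u N : real_schwartz u -> exists M : R,
  forall j k x, (j <= N)%N -> (k <= N)%N -> `|x ^+ j * derive1n k u x| <= M.
Proof.
move=> [_ bu].
have [B uB] : exists B : nat -> nat -> R,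
    forall j k x, `|x ^+ j * derive1n k u x| <= B j k.
  have /choice[B uB] : forall jk : nat * nat, exists M : R,
      forall x, `|x ^+ jk.1 * derive1n jk.2 u x| <= M by move=> [j k]; exact: bu.
  by exists (fun j k => B (j, k)) => j k x; exact: (uB (j, k)).
have B0 j k : 0 <= B j k by apply: le_trans (uB j k 0).
exists (\sum_(j < N.+1) \sum_(k < N.+1) B j k) => j k x jN kN.
apply: (le_trans (uB j k x)).
rewrite (bigD1 (Ordinal (jN : (j < N.+1)%N)))//= (bigD1 (Ordinal (kN : (k < N.+1)%N)))//=.
by rewrite -addrA lerDl addr_ge0// sumr_ge0// => i _; rewrite sumr_ge0.
Qed.

Lemma schwartz_complex u v : real_schwartz u -> real_schwartz v ->
  schwartz (fun x => u x +i* v x).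
Proof.
move=> su sv; split=> [k x|N]; first by split; [case: su|case: sv].
have [Mu uM] := real_schwartz_uniform N su.
have [Mv vM] := real_schwartz_uniform N sv.
exists (Mu + Mv) => j k x jN kN; rewrite mulC_cderiven /=.
apply: (le_trans (normc_le_ReDIm _ _)); apply: lerD; [exact: uM|exact: vM].
Qed.

(** The preimage is the inverse transform of f, written out in real and
imaginary parts. In the transform of it the mixed terms cancel by
[phase_transform_commute], and the rest is the inversion formula. *)
Lemma fourier_surjective f : schwartz f ->
  exists2 g, schwartz g & fourier g = f.
Proof.
move=> sf; have su := schwartz_Re sf; have sv := schwartz_Im sf.
pose u := reP f; pose v := imP f.
pose c : R := (2 * pi)^-1.
have c0 : 2 * pi != 0 :> R by rewrite mulf_neq0// gt_eqF// pi_gt0.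
have s0u := real_schwartz_phase_transform 0 su.
have s1u := real_schwartz_phase_transform (- (pi / 2)) su.
have s0v := real_schwartz_phase_transform 0 sv.
have s1v := real_schwartz_phase_transform (- (pi / 2)) sv.
have sN1v := real_schwartz_scale (-1) s1v.
pose a x := c * (W 0 u x + -1 * W (- (pi / 2)) v x).
pose b x := c * (W (- (pi / 2)) u x + W 0 v x).
have sa : real_schwartz a by apply/real_schwartz_scale/real_schwartz_add.
have sb : real_schwartz b by apply/real_schwartz_scale/real_schwartz_add.
exists (fun x => a x +i* b x); first exact: schwartz_complex.
apply/funext => xi.
have L := @real_schwartz_L1 R.
have Wa p : W p a xi = c * (W p (W 0 u) xi - W p (W (- (pi / 2)) v) xi).
  rewrite phase_transformZ; last by apply: L; exact: real_schwartz_add.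
  rewrite phase_transformD; [|exact: L..].
  by rewrite phase_transformZ ?mulN1r//; exact: L.
have Wb p : W p b xi = c * (W p (W (- (pi / 2)) u) xi + W p (W 0 v) xi).
  rewrite phase_transformZ; last by apply: L; exact: real_schwartz_add.
  by rewrite phase_transformD; [|exact: L..].
rewrite fourierE; [|exact: L..].
rewrite -/a -/b !Wa !Wb.
rewrite !(phase_transform_commute _ su) !(phase_transform_commute _ sv) -/u -/v.
have Iu := phase_transform_inversion xi su; have Iv := phase_transform_inversion xi sv.
rewrite -/u -/v in Iu Iv.
have -> : f xi = u xi +i* v xi by rewrite /u /v; case: (f xi).
congr (_ +i* _).
  by rewrite -mulrDr addrACA addNr addr0 Iu mulrA mulVf// mul1r.
by rewrite -mulrBr opprB addrC addrA subrK addrC Iv mulrA mulVf// mul1r.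
Qed.

Lemma distr_of_realE b f :
  distr_of (fun x => (b x)%:C) f =
  (\int[mu]_x (b x * complex.Re (f x))) +i* (\int[mu]_x (b x * complex.Im (f x))).
Proof.
rewrite /distr_of /cintegral; congr (_ +i* _); apply: eq_Rintegral => x _.
  by rewrite ReM /= mul0r subr0.
by rewrite ImM /= mul0r addr0.
Qed.

Lemma L1_mul_schwartz b u : L1 b -> real_schwartz u -> L1 (fun x => b x * u x).
Proof.
move=> Lb su; have [M uM] := real_schwartz_bounded su.
apply: (L1_mul_bounded (C := M)) => //.
by apply: continuous_measurable_fun; exact: real_schwartz_continuous.
Qed.

(** Pairing with an integrable function is bounded by its L1 norm times the
supremum of the test function, the seminorm of order 0; the factor 2 pays
for treating real and imaginary parts separately. *)
Lemma tempered_L1 b : L1 b -> tempered (distr_of (fun x => (b x)%:C)).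
Proof.
move=> Lb; split=> [a f g sf sg|].
  have sfr := schwartz_Re sf; have sfi := schwartz_Im sf.
  have sgr := schwartz_Re sg; have sgi := schwartz_Im sg.
  have Lfr := L1_mul_schwartz Lb sfr; have Lfi := L1_mul_schwartz Lb sfi.
  have Lgr := L1_mul_schwartz Lb sgr; have Lgi := L1_mul_schwartz Lb sgi.
  rewrite !distr_of_realE; case: a => r i.
  set A := \int[mu]_x (b x * complex.Re (f x)).
  set B := \int[mu]_x (b x * complex.Im (f x)).
  set C := \int[mu]_x (b x * complex.Re (g x)).
  set D := \int[mu]_x (b x * complex.Im (g x)).
  have -> : (r +i* i) * (A +i* B) + (C +i* D) =
    (r * A - i * B + C) +i* (r * B + i * A + D) by [].
  rewrite /A /B /C /D; congr (_ +i* _).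
    rewrite -!RintegralZl// -RintegralB//; [|exact: L1_scale..].
    rewrite -RintegralD//; last by apply: L1_sub; exact: L1_scale.
    by apply: eq_Rintegral => x _; rewrite ReD ReM /=; ring.
  rewrite -!RintegralZl// -RintegralD//; [|exact: L1_scale..].
  rewrite -RintegralD//; last by apply: L1_add; exact: L1_scale.
  by apply: eq_Rintegral => x _; rewrite ImD ImM /=; ring.
exists 0%N, (2 * \int[mu]_x `|b x|) => f M sf fM.
have sfr := schwartz_Re sf; have sfi := schwartz_Im sf.
have mfr := continuous_measurable_fun (real_schwartz_continuous sfr).
have mfi := continuous_measurable_fun (real_schwartz_continuous sfi).
have fxM x : Normc.normc (f x) <= M.
  have := fM 0%N 0%N x isT isT; rewrite mulC_cderiven !mul1r /=.
  by case: (f x).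
rewrite distr_of_realE (le_trans (normc_le_ReDIm _ _))//.
rewrite -mulrA mulr_natl mulr2n lerD// integral_bound// => x.
  by apply: le_trans (fxM x); case: (f x) => r i; exact: normc_ge_Re.
by apply: le_trans (fxM x); case: (f x) => r i; exact: normc_ge_Im.
Qed.

(** Self-adjointness moves each W p from the test function to the spline,
whose transform is cos p times a power of sinc: phase -pi/2 contributes
nothing, since the spline is even. *)
Lemma fourier_bspline n :
  distr_eq (distr_fourier (@bspline_distr R n))
    (distr_of (fun xi => (sinc (xi / 2) ^+ n.+1)%:C)).
Proof.
move=> f sf; have su := schwartz_Re sf; have sv := schwartz_Im sf.
have Lu := real_schwartz_L1 su; have Lv := real_schwartz_L1 sv.
have Lb := @L1_bspline R n.
rewrite /distr_fourier /bspline_distr !distr_of_realE.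
have self q w : L1 w -> \int[mu]_x (bspline n x * W q w x) =
    \int[mu]_x (w x * (cos q * sinc (x / 2) ^+ n.+1)).
  move=> Lw; rewrite phase_transform_selfadjoint//.
  by apply: eq_Rintegral => x _; rewrite phase_transform_bspline.
have self0 w : L1 w -> \int[mu]_x (bspline n x * W 0 w x) =
    \int[mu]_x (sinc (x / 2) ^+ n.+1 * w x).
  by move=> Lw; rewrite self//; apply: eq_Rintegral => x _; rewrite cos0 mul1r mulrC.
have self1 w : L1 w -> \int[mu]_x (bspline n x * W (- (pi / 2)) w x) = 0.
  move=> Lw; rewrite self//.
  under eq_Rintegral do rewrite cosN cos_pihalf mul0r mulr0.
  by rewrite Rintegral_cst// mul0r.
congr (_ +i* _).
  rewrite -(self0 _ Lu) -[RHS]addr0 -[X in _ = _ + X](self1 _ Lv) -RintegralD//; last 2 first.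
  - exact: L1_mul_phase_transform.
  - exact: L1_mul_phase_transform.
  by apply: eq_Rintegral => x _; rewrite fourierE//= mulrDr.
rewrite -(self0 _ Lv) -[RHS]subr0 -[X in _ = _ - X](self1 _ Lu) -RintegralB//; last 2 first.
- exact: L1_mul_phase_transform.
- exact: L1_mul_phase_transform.
by apply: eq_Rintegral => x _; rewrite fourierE//= mulrBr.
Qed.

Lemma phihat_orderE (m : nat) (xi : R) :
  phihat_order m xi = sinc (xi / 2) ^+ (2 * m).
Proof. by rewrite /phihat_order phihatE exprM. Qed.

Lemma elliptic_scaling_bspline (m : nat) : (1 <= m)%N ->
  elliptic_scaling m (@bspline_distr R (2 * m - 1)).
Proof.
move=> m1; split; first exact/tempered_L1/L1_bspline.
move=> f sf; rewrite fourier_bspline//; congr (distr_of _ f).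
by apply/funext => xi; rewrite phihat_orderE subn1 prednK// muln_gt0.
Qed.

(** Both distributions agree on Fourier transforms of Schwartz functions, and
every Schwartz function is one. *)
Lemma elliptic_scaling_unique (m : nat) (S T : @functional R) :
  elliptic_scaling m S -> elliptic_scaling m T -> distr_eq S T.
Proof.
move=> [_ HS] [_ HT] f /fourier_surjective[g sg <-].
by have := HS g sg; rewrite -(HT g sg).
Qed.

Lemma fourier_bspline_fun n (xi : R) :
  fourier (fun x => (bspline n x)%:C) xi = (sinc (xi / 2) ^+ n.+1)%:C.
Proof.
have L0 : L1 (fun=> 0) by exact: integrable0.
rewrite fourierE; [|exact: L1_bspline|exact: L0].
rewrite !phase_transform_bspline cosN cos_pihalf cos0 mul1r mul0r subr0.
have W00 q : W q (fun=> 0) xi = 0.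
  rewrite /phase_transform; under eq_Rintegral do rewrite mul0r.
  by rewrite Rintegral_cst// mul0r.
by rewrite /= !W00 addr0.
Qed.

End ComplexAssembly.

Theorem mainTheorem8 (R : realType) :
  (forall xi : R, cvgn (phihat_partial xi)) /\
  (forall m : nat, (1 <= m)%N ->
     elliptic_scaling m (bspline_distr (2 * m - 1) : @functional R) /\
     (forall T : @functional R, elliptic_scaling m T ->
        distr_eq T (bspline_distr (2 * m - 1))) /\
     (forall xi : R, phihat_order m xi = sinc (xi / 2) ^+ (2 * m)) /\
     (forall xi : R, fourier (fun x : R => (bspline (2 * m - 1) x)%:C) xi
        = (sinc (xi / 2) ^+ (2 * m))%:C)) /\
  (forall n : nat, odd n -> exists m : nat,
     (1 <= m)%N /\ elliptic_scaling m (bspline_distr n : @functional R)).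
Proof.
split; first by move=> xi; apply/cvg_ex; eexists; exact: cvg_phihat_partial.
split=> [m m1|n n_odd].
  have ES := elliptic_scaling_bspline (R := R) m1.
  split=> //; split; first by move=> T ET; exact: elliptic_scaling_unique ET ES.
  split=> xi; first exact: phihat_orderE.
  by rewrite fourier_bspline_fun subn1 prednK// muln_gt0.
have m1 : (1 <= uphalf n)%N by case: n n_odd.
exists (uphalf n); split=> //.
(* An odd n is 2m - 1 for m = (n + 1)/2, which is uphalf n. *)
have {2}-> : n = (2 * uphalf n - 1)%N.
  by rewrite mul2n uphalf_half n_odd -[LHS]odd_double_half n_odd doubleD subn1.
exact: elliptic_scaling_bspline.
Qed.
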